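(* Let $N\ge 2$, let $X_1=\mathbb{R}$ with a Borel probability measure $\mu_1$ whose support is not compact, and for $j=2,\dotsc,N$ let $X_j=[-\tfrac12,\tfrac12]$ with $\mu_j$ the Lebesgue measure. Then there exist a coupling $P$ on $X=X_1\times\dotsb\times X_N$ and $\varepsilon>0$ such that for every $\sigma>0$ there exist marginals $\rho_j\in C(X_j)$, $j=1,\dotsc,N$, with $\lVert\pi_jP-\rho_j\rVert_{L^\infty(\mu_j)}<\sigma$ for every $j$, but such that no $P'\in\Pi(\rho_1,\dotsc,\rho_N)$ satisfies $\lVert P-P'\rVert_{L^\infty(\mu)}<\varepsilon$.
   Context: The spaces $X_j$ carry the Euclidean distance; $X=X_1\times\dotsb\times X_N$ carries the product measure $\mu=\mu_1\otimes\dotsb\otimes\mu_N$ and the distance $d(x,x')=\sum_{j=1}^N |x_j-x_j'|$. A function $\rho_j\in C(X_j)$ is called a marginal if $\rho_j\ge 0$ and $\int_{X_j}\rho_j\,d\mu_j=1$. For a function $P$ on $X$, $\pi_jP$ denotes its $j$-th marginal, the function on $X_j$ obtained by integrating $P$ with respect to all the measures $\mu_1,\dotsc,\mu_N$ except $\mu_j$. Given marginals $\rho_1,\dotsc,\rho_N$, set $$\Pi(\rho_1,\dotsc,\rho_N)=\{P\in C(X) : P\ge 0,\ \pi_jP=\rho_j \text{ for all } j=1,\dotsc,N\}.$$ A coupling is an element of $\Pi(\rho_1,\dotsc,\rho_N)$ for some marginals $\rho_1,\dotsc,\rho_N$. *)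

(* Defs.v *)
From HB Require Import structures.
From mathcomp Require Import all_boot all_order all_algebra.
From mathcomp Require Import all_classical all_reals all_analysis.

Set Implicit Arguments.
Unset Strict Implicit.
Unset Printing Implicit Defensive.

Import Order.TTheory GRing.Theory Num.Theory.
Import numFieldNormedType.Exports.

Local Open Scope classical_set_scope.
Local Open Scope ring_scope.

(* A point of X_1 x ... x X_n, each X_j a subset of the line, is a tuple of
   reals; the sigma-algebra on tuples is generated by the coordinates. *)
Definition box (R : realType) (n : nat) (X : 'I_n -> set R) :
    set (n.-tuple (measurableTypeR R)) :=
  [set x | forall j, X j (tnth x j)].

Section product_measure.
Context {R : realType}.
Local Notation T := (measurableTypeR R).

Definition tcons (n : nat) (x : T * n.-tuple T) : n.+1.-tuple T :=
  [the n.+1.-tuple T of x.1 :: x.2].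

Lemma measurable_tcons (n : nat) :
  measurable_fun [set: T * n.-tuple T] (@tcons n).
Proof. exact: measurable_cons. Qed.

HB.instance Definition _ (n : nat) :=
  isMeasurableFun.Build _ _ _ _ (@tcons n) (@measurable_tcons n).

(* mu_1 \otimes ... \otimes mu_n, by iterating the binary product measure and
   transporting it along the identification of T * T^n with T^(n+1) *)
Fixpoint prodm (n : nat) :
    ('I_n -> probability T R) -> probability (n.-tuple T) R :=
  match n with
  | 0 => fun=> dirac ([tuple] : 0.-tuple T)
  | m.+1 => fun mu => distribution
      (mu ord0 \x prodm (fun i => mu (lift ord0 i)))%E (@tcons m)
  end.

Lemma measurable_box (n : nat) (A : 'I_n -> set T) :
  (forall j, measurable (A j)) -> measurable (box A : set (n.-tuple T)).
Proof.
move=> mA; rewrite (_ : box A = \bigcap_(j in [set: 'I_n])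
  ((fun x : n.-tuple T => tnth x j) @^-1` A j)); last first.
  by apply/seteqP; split=> x /= h j => [_|]; exact: h.
apply: fin_bigcap_measurable; first exact: finite_finset.
move=> j _; rewrite -[X in measurable X]setTI.
exact: (@measurable_tnth _ T n j measurableT _ (mA j)).
Qed.

Lemma prodm_box (n : nat) (mu : 'I_n -> probability T R) (A : 'I_n -> set T) :
  (forall j, measurable (A j)) ->
  prodm mu (box A) = (\prod_(j < n) mu j (A j))%E.
Proof.
elim: n mu A => [|n IH] mu A mA.
  by rewrite big_ord0 /= diracE mem_set// => -[].
rewrite big_ord_recl /= /distribution /pushforward.
rewrite (_ : _ @^-1` _ =
  A ord0 `*` (box (fun i => A (lift ord0 i)) : set (n.-tuple T))).
  rewrite product_measure1E//.
    by congr (_ * _)%E; apply: IH => j; exact: mA.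
  by apply: measurable_box => i; exact: mA.
apply/seteqP; split=> -[a y] /=.
  move=> h; split=> [|i]; first exact: (h ord0).
  by have := h (lift ord0 i); rewrite /tcons tnthS.
move=> [a0 h] j; case: (unliftP ord0 j) => [i ->|-> //].
by rewrite /tcons tnthS; exact: h.
Qed.

End product_measure.

Section couplings.
Context {R : realType}.
Local Notation T := (measurableTypeR R).

Definition msupport (mu : probability T R) : set R :=
  [set x | forall U : set R, open_nbhs x U -> (0 < mu U)%E].

(* Here and below each X j is meant to carry mu j, that is mu j (~` X j) = 0,
   and functions on X j (on box X) are functions on the line (on tuples) whose
   values outside X j (outside box X) are irrelevant. *)

Definition is_marginal (X : set R) (mu : probability T R) (rho : R -> R) :=
  [/\ {within X, continuous rho},
      forall t, X t -> 0 <= rho t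
    & (\int[mu]_(t in X) (rho t)%:E = 1)%E].

Definition of_row (n : nat) (v : 'rV[R]_n) : n.-tuple T :=
  [tuple v ord0 j | j < n].

(* Tuples are identified with row vectors, whose topology is that of the
   distance \sum_j `|x_j - x'_j|. *)
Definition continuous_on (n : nat) (X : 'I_n -> set R) (P : n.-tuple T -> R) :=
  {within @of_row n @^-1` box X, continuous (P \o @of_row n)}.

(* the point with j-th coordinate t whose other coordinates are, in order,
   those of y *)
Definition insert_at (n : nat) (j : 'I_n) (t : R) (y : n.-1.-tuple T) :
    n.-tuple T :=
  [tuple if unlift j i is Some k then tnth y k else t | i < n].

(* \pi_j P: integration over the coordinates other than j. It is a priori only
   extended-real-valued, so transport_plans requires it to be finite. *)
Definition marg (n : nat) (X : 'I_n -> set R) (mu : 'I_n -> probability T R)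
    (j : 'I_n) (P : n.-tuple T -> R) (t : R) : \bar R :=
  (\int[prodm (fun k => mu (lift j k))]_(y in box (fun k => X (lift j k)))
     (P (insert_at j t y))%:E)%E.

(* \Pi(rho_1, ..., rho_n) *)
Definition transport_plans (n : nat) (X : 'I_n -> set R)
    (mu : 'I_n -> probability T R) (rho : 'I_n -> R -> R) :
    set (n.-tuple T -> R) :=
  [set P | [/\ continuous_on X P,
               forall x, box X x -> 0 <= P x
             & forall j t, X j t -> marg X mu j P t = (rho j t)%:E]].

Definition coupling (n : nat) (X : 'I_n -> set R) (mu : 'I_n -> probability T R)
    (P : n.-tuple T -> R) :=
  exists2 rho : 'I_n -> R -> R,
    (forall j, is_marginal (X j) (mu j) (rho j)) & transport_plans X mu rho P.

Definition unit_itv : set R := `[- 2^-1, 2^-1].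

Lemma measurable_unit_itv : measurable (unit_itv : set T).
Proof. exact: measurable_itv. Qed.

Definition unit_lebesgue : set T -> \bar R :=
  mrestr lebesgue_measure measurable_unit_itv.

HB.instance Definition _ := Measure.on unit_lebesgue.

Lemma unit_lebesgue_setT : unit_lebesgue [set: T] = 1%E.
Proof.
rewrite /unit_lebesgue /mrestr setTI /unit_itv lebesgue_measure_itv /=.
rewrite lte_fin gtrN ?invr_gt0// -EFinD opprK.
by rewrite -[2^-1]mul1r -splitr.
Qed.

HB.instance Definition _ :=
  Measure_isProbability.Build _ _ _ unit_lebesgue unit_lebesgue_setT.

(* X_1 = R, mu_1 arbitrary, and X_j = [-1/2, 1/2] with the Lebesgue measure for
   the other j; coordinates are numbered from 0 here. *)
Definition coord_space (N : nat) (j : 'I_N) : set R :=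
  if j == 0%N :> nat then setT else unit_itv.

Definition coord_measure (N : nat) (mu1 : probability T R) (j : 'I_N) :
    probability T R :=
  if j == 0%N :> nat then mu1 else unit_lebesgue.

End couplings.

(* Main.v *)
Require Import Defs.
From HB Require Import structures.
From mathcomp Require Import all_boot all_order all_algebra.
From mathcomp Require Import all_classical all_reals all_analysis.
From mathcomp Require Import measurable_realfun ess_sup_inf ring lra.

Import Order.TTheory GRing.Theory Num.Theory.
Import numFieldNormedType.Exports.

Local Open Scope classical_set_scope.
Local Open Scope ring_scope.

(* The plan is [P x = tent (H x_1) x_2], where [tent h] is a bump of mass 1 on
   [-1/2, 1/2], of height [2 h] and width [1/h], and [H >= 1] is continuous,
   tends to infinity at infinity, and is [mu_1]-integrable; integrability
   makes the second marginal finite and continuous, while the other marginals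
   are 1. A plan within distance 1 of [P] keeps at least the mass [1 - 1/H s]
   on the slice [x_1 = s]. The marginal [1 + delta (1/H - c)], with [c] the
   [mu_1]-mean of [1/H], is within [delta] of 1 but at most [1 - delta c / 2]
   far away, hence is not the first marginal of such a plan, since the support
   of [mu_1] is unbounded. *)

(** * A continuous integrable function on the line that tends to infinity *)

Section proper_integrable.
Context {R : realType}.
Local Notation T := (measurableTypeR R).

Lemma measurable_tail (r : R) : measurable ([set x | r < `|x|] : set T).
Proof.
rewrite (_ : [set x | _] = Num.norm @^-1` `]r, +oo[); last first.
  by apply/seteqP; split=> x /=; rewrite in_itv/= andbT.
by rewrite -[X in measurable X]setTI; exact: normr_measurable.
Qed.

(** The tails decrease to the empty set, so continuity from above of a finite measure applies. *)
Lemma cvg_measure_tail (mu : probability T R) :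
  mu [set x | n%:R < `|x|] @[n --> \oo] --> 0%E.
Proof.
pose F n : set T := [set x | n%:R < `|x|].
have mF n : measurable (F n).
  exact: measurable_tail.
have F0 : \bigcap_n F n = set0.
  apply/seteqP; split=> // x /(_ (Num.bound `|x|) I) /=.
  by apply/negP; rewrite -leNgt ltW// archi_boundP.
rewrite -(@measure0 _ _ _ mu) -F0.
apply: (@nonincreasing_cvg_mu _ _ _ mu F) => //.
- by rewrite (le_lt_trans (probability_le1 _ _)) ?ltry.
- by rewrite F0.
- move=> m n mn; apply/subsetPset => x /=.
  by apply: le_lt_trans; rewrite ler_nat.
Qed.

(* [H] grows by one past each of the radii [r n], which are taken so large that
   the layers have summable masses. *)
Lemma exists_proper_integrable (mu : probability T R) :
  exists H : R -> R, [/\ continuous H, forall x, 1 <= H x,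
    forall A, exists M, forall x, M <= `|x| -> A <= H x &
    mu.-integrable setT (EFin \o H)].
Proof.
(* The bound [n <= m] drives the radii to infinity, which makes the sum of ramps below locally
   finite; the masses [1 / 2 ^ n.+1] have sum 1. *)
have tail n : exists m, ((n <= m)%N /\
    (mu [set x | m%:R < `|x|]%R <= (1 / (2 ^ n.+1)%:R)%:E)%E).
  have n0 : (0 < (1 / (2 ^ n.+1)%:R)%:E :> \bar R)%E.
    by rewrite lte_fin divr_gt0// ltr0n expn_gt0.
  have := @open_nbhs_nbhs _ _ _ (conj (@open_ereal_lt_ereal _ _) n0).
  move=> /(@cvg_measure_tail mu)[m _ /(_ (maxn m n) (leq_maxl _ _))/= h].
  by exists (maxn m n); rewrite leq_maxr ltW.
have [r rP] := choice tail.
(* A continuous ramp: 0 up to radius [r n], 1 from radius [r n + 1] on. *)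
pose k n (x : R) : R := Num.min 1 (Num.max 0 (`|x| - (r n)%:R)).
have k0 n x : 0 <= k n x by rewrite /k le_min ler01 le_max lexx.
have kE n m x : `|x| <= m%:R -> (m <= n)%N -> k n x = 0.
  move=> xm mn; rewrite /k max_l ?min_r// subr_le0 (le_trans xm)// ler_nat.
  by rewrite (leq_trans mn)// (rP n).1.
have kc n : continuous (k n : R -> R).
  have c0 : continuous (cst 0 \max (fun x : R => `|x| - (r n)%:R)).
    apply: max_fun_continuous; first exact: cst_continuous.
    by move=> x; apply: cvgB; [exact: norm_continuous|exact: cvg_cst].
  have c1 : continuous (cst 1 : R -> R) by exact: cst_continuous.
  exact: (min_fun_continuous c1 c0).
(* Terms past the cutoff vanish because [n <= r n], so [psi] is the full series and any larger
   cutoff gives the same value. *)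
pose psi (x : R) : R := \sum_(0 <= n < Num.bound `|x|) k n x.
have psiE m x : `|x| <= m%:R -> psi x = \sum_(0 <= n < m) k n x.
  have aux p q : `|x| <= p%:R -> (p <= q)%N ->
      \sum_(0 <= n < q) k n x = \sum_(0 <= n < p) k n x.
    move=> xp pq; rewrite (big_cat_nat (leq0n p) pq)/= [X in _ + X]big_nat.
    by rewrite [X in _ + X]big1 ?addr0// => i /andP[pi _]; rewrite (kE i p).
  move=> xm; have xb : `|x| <= (Num.bound `|x|)%:R.
    by rewrite ltW// archi_boundP.
  have [h|h] := leqP m (Num.bound `|x|); rewrite /psi.
    by rewrite (aux _ _ xm h).
  by rewrite (aux _ _ xb (ltnW h)).
have psi0 x : 0 <= psi x by apply: sumr_ge0.
have sumc m : continuous (fun x : R => \sum_(0 <= n < m) k n x).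
  elim: m => [|m IH].
    by under eq_fun do rewrite big_geq//; exact: cst_continuous.
  under eq_fun do rewrite big_nat_recr//=.
  by move=> x; apply: cvgD; [exact: IH|exact: kc].
have psic : continuous psi.
  (* One cutoff serves the whole ball of radius 1 about [x], so [psi] is a fixed finite sum
     there. *)
  move=> x; pose m := Num.bound (`|x| + 1).
  have xm : `|x| + 1 < m%:R by rewrite archi_boundP// addr_ge0.
  have Sc := @sumc m x.
  rewrite /continuous_at (psiE m); last first.
    by rewrite ltW// (lt_trans _ xm)// ltrDl.
  apply: cvg_trans Sc; apply: near_eq_cvg.
  near=> y; rewrite (psiE m)//.
  have : `|x - y| < 1 by near: y; exact: cvgr_dist_lt.
  move=> xy; rewrite (le_trans _ (ltW xm))//.
  rewrite -[y](subrK x) (le_trans (ler_normD _ _))// addrC lerD2l.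
  by rewrite distrC ltW.
have Hc : continuous (fun x => 1 + psi x).
  by move=> x; apply: cvgD; [exact: cvg_cst|exact: psic].
exists (fun x => 1 + psi x); split => //.
- by move=> x; rewrite lerDl.
- move=> A; pose m := Num.bound `|A|.
  (* The sum of the radii dominates each of them, so past this point the first [m] ramps all equal 1
     and [psi] is at least [m]. *)
  exists ((\sum_(i < m) r i)%:R + 1) => x Mx.
  have k1 i : (i < m)%N -> k i x = 1.
    move=> im; rewrite /k min_l// le_max; apply/orP; right.
    rewrite lerBrDr addrC (le_trans _ Mx)// lerD2r ler_nat.
    by rewrite (bigD1 (Ordinal im))//= leq_addr.
  have Am : A <= m%:R.
    by rewrite (le_trans (ler_norm A))// ltW// archi_boundP.
  rewrite (le_trans Am)// (@le_trans _ _ (psi x)) ?lerDr//.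
  pose q := maxn m (Num.bound `|x|).
  rewrite (psiE q); last first.
    rewrite (@le_trans _ _ (Num.bound `|x|)%:R) ?ler_nat ?leq_maxr//.
    by rewrite ltW// archi_boundP.
  rewrite (big_cat_nat (leq0n m) (leq_maxl _ _))/= [X in X + _]big_nat.
  rewrite (eq_bigr (fun=> 1)); last by move=> i /andP[_ im]; exact: k1.
  by rewrite -big_nat big_const_nat subn0 iter_addr_0 lerDl sumr_ge0.
- have mH : measurable_fun setT (EFin \o (fun x => 1 + psi x)).
    by apply/measurable_EFinP; exact: continuous_measurable_fun.
  have mk n : measurable_fun setT (EFin \o k n).
    by apply/measurable_EFinP; exact: continuous_measurable_fun.
  have mpsi : measurable_fun setT (EFin \o psi).
    by apply/measurable_EFinP; exact: continuous_measurable_fun.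
  apply/integrableP; split => //.
  under eq_integral do rewrite /= ger0_norm ?addr_ge0// EFinD.
  rewrite ge0_integralD//=; last by move=> x _; rewrite lee_fin.
  rewrite (integral_cst mu measurableT 1%E) mul1e.
  rewrite lte_add_pinfty//; first
    by rewrite (le_lt_trans (probability_le1 _ _)) ?ltry.
  (* The series is integrated termwise: each ramp is at most the indicator of its tail, of mass at
     most [1 / 2 ^ n.+1]. *)
  apply: (@le_lt_trans _ _ (\int[mu]_x \sum_(0 <= n <oo) (k n x)%:E)%E).
    apply: ge0_le_integral => //.
    + by move=> x _; rewrite lee_fin.
    + apply: ge0_emeasurable_sum => [n x _ _|n _]; first by rewrite lee_fin.
      exact: mk.
    + move=> x _; rewrite /= /psi -sumEFin.
      by apply: nneseries_lim_ge => // n _ _; rewrite lee_fin.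
  rewrite integral_nneseries//; last by move=> n x _; rewrite lee_fin.
  apply: (@le_lt_trans _ _ 1%E); last exact: ltry.
  have /= := @epsilon_trick0 R 1 xpredT ler01; apply: le_trans.
  apply: lee_nneseries => [n _ _|n _]; first
    by apply: integral_ge0 => x _; rewrite lee_fin.
  have mA := measurable_tail (r n)%:R.
  rewrite (le_trans _ (rP n).2)// -(setIT [set x | _]) -integral_indic//.
  apply: ge0_le_integral => //.
  + by move=> x _; rewrite lee_fin.
  + exact: mk.
  + by apply/measurable_EFinP; exact: measurable_indic.
  + move=> x _; rewrite lee_fin indicE.
    have [xr|xr] := ltP (r n)%:R (`|x| : R).
      by rewrite mem_set// ge_min lexx.
    by rewrite /k max_l ?subr_le0// min_r// ler0n.
Unshelve. all: by end_near. Qed.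
End proper_integrable.

(** * Integration against the iterated product measure *)

Section prodm_integral.
Context {R : realType}.
Local Notation T := (measurableTypeR R).
Local Open Scope ereal_scope.

Lemma ge0_integral_prodmS (n : nat) (mu : 'I_n.+1 -> probability T R)
    (f : n.+1.-tuple T -> \bar R) :
  measurable_fun setT f -> (forall y, 0 <= f y) ->
  \int[prodm mu]_y f y = \int[mu ord0]_a
    \int[prodm (fun i => mu (lift ord0 i))]_z f (tcons (a, z)).
Proof.
move=> mf f0.
rewrite [LHS]ge0_integral_distribution// fubini_tonelli1//.
- by apply: measurableT_comp.
- by move=> z; exact: f0.
Qed.

Lemma prodm_box_full (n : nat) (mu : 'I_n -> probability T R)
    (X : 'I_n -> set T) : (forall j, measurable (X j)) ->
  (forall j, mu j (X j) = 1) -> prodm mu (box X) = 1.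
Proof. by move=> mX muX; rewrite prodm_box// big1. Qed.

(** The complement of a box of full measure is negligible. This passes from [marg], which integrates
    over a box, to integrals over all tuples, where Tonelli applies. *)
Lemma ge0_integral_prodm_box (n : nat) (mu : 'I_n -> probability T R)
    (X : 'I_n -> set T) (f : n.-tuple T -> \bar R) :
  (forall j, measurable (X j)) -> (forall j, mu j (X j) = 1) ->
  measurable_fun setT f -> (forall y, 0 <= f y) ->
  \int[prodm mu]_(y in box X) f y = \int[prodm mu]_y f y.
Proof.
move=> mX muX mf f0.
have mB := measurable_box mX.
rewrite [RHS](@ge0_negligible_integral _ _ _ _ _ (~` box X))//.
- by rewrite setTD setCK.
- exact: measurableC.
- transitivity (1 - prodm mu (box X)); first exact: probability_setC.
  by rewrite prodm_box_full// subee.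
Qed.

(** The inner integrand is constant, and its integral against a probability measure is that
    constant. *)
Lemma ge0_integral_prodm_coord0 (n : nat) (mu : 'I_n.+1 -> probability T R)
    (g : T -> \bar R) : measurable_fun setT g -> (forall a, 0 <= g a) ->
  \int[prodm mu]_y g (tnth y ord0) = \int[mu ord0]_a g a.
Proof.
move=> mg g0; rewrite ge0_integral_prodmS//; last first.
  by apply: measurableT_comp => //; exact: measurable_tnth.
apply: eq_integral => a _.
rewrite (eq_integral (cst (g a))); last by move=> z _.
rewrite integral_cst//.
by rewrite [X in _ * X](_ : _ = 1) ?mule1//; exact: probability_setT.
Qed.

Lemma ge0_integral_prodm_coord01 (n : nat) (mu : 'I_n.+2 -> probability T R)
    (g : T * T -> \bar R) : measurable_fun setT g -> (forall a, 0 <= g a) ->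
  \int[prodm mu]_y g (tnth y ord0, tnth y (lift ord0 ord0)) =
  \int[mu ord0]_a \int[mu (lift ord0 ord0)]_b g (a, b).
Proof.
move=> mg g0; rewrite ge0_integral_prodmS//; last first.
  apply: measurableT_comp => //.
  by apply/measurable_fun_pair; exact: measurable_tnth.
apply: eq_integral => a _.
rewrite -(ge0_integral_prodm_coord0 _ (fun i => mu (lift ord0 i))
    (fun b => g (a, b)))//; last exact: measurableT_comp.
by apply: eq_integral => z _; congr (g (_, _)); rewrite !(tnth_nth a).
Qed.

(* No measurability is required of [g]: a simple function below [f] is below
   [g]. *)
Lemma ge0_le_integral_nonmeasurable d (Y : measurableType d)
    (mu : {measure set Y -> \bar R}) (D : set Y) (f g : Y -> \bar R) :
  (forall x, D x -> 0 <= f x) -> (forall x, D x -> f x <= g x) ->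
  \int[mu]_(x in D) f x <= \int[mu]_(x in D) g x.
Proof.
move=> f0 fg; rewrite !(integral_mkcond D).
rewrite !ge0_integralTE; first last.
- by move=> x; apply: erestrict_ge0.
- by move=> x; apply: erestrict_ge0 => y Dy; rewrite (le_trans (f0 _ Dy)) ?fg.
apply: le_ereal_sup => _ /= [h hf <-]; exists h => // x.
by rewrite (le_trans (hf x))//; exact: lee_restrict.
Qed.

End prodm_integral.

(** * Tents of mass 1 on the unit interval *)

Section tent.
Context {R : realType}.
Local Notation T := (measurableTypeR R).

(** The interval has length 1, so its uniform probability has density 1 and agrees with
    [unit_lebesgue] on measurable sets. *)
Lemma ge0_integral_unit_lebesgue (f : T -> \bar R) :
  measurable_fun setT f -> (forall t, 0 <= f t)%E ->
  (\int[unit_lebesgue]_t f t = \int[lebesgue_measure]_(t in unit_itv) f t)%E.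
Proof.
move=> mf f0.
have lt12 : - 2^-1 < 2^-1 :> R by lra.
rewrite (eq_measure_integral (uniform_prob lt12)) => [|A mA _].
  rewrite integral_uniform// (_ : (_ - _)^-1 = 1) ?mul1e//.
  by rewrite opprK -[2^-1]mul1r -splitr invr1.
have := integral_uniform lt12 (f := EFin \o \1_A).
rewrite integral_indic// setIT => ->.
- rewrite opprK -[X in (X + X)^-1]mul1r -splitr invr1 mul1e integral_indic//.
- by apply/measurable_EFinP; exact: measurable_indic.
- by move=> x; rewrite lee_fin.
Qed.

(* The factor 2 makes a half-tent of height [2 * h] and base [h^-1], which is
   what is left of the tent on [- 2^-1, 2^-1], have mass 1. *)
Definition tent (h t : R) : R := 2 * h * Num.max 0 (1 - h * `|t + 2^-1|).

Lemma tent_ge0 (h t : R) : 0 <= h -> 0 <= tent h t.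
Proof. by move=> h0; rewrite !mulr_ge0// le_max lexx. Qed.

Lemma tent_le (h t : R) : 0 <= h -> tent h t <= 2 * h.
Proof.
move=> h0; rewrite ler_piMr ?mulr_ge0// ge_max ler01 gerBl.
by rewrite mulr_ge0.
Qed.

(** Stated along an arbitrary filter, to serve both the continuity of the plan and the continuity
    under the integral of its second marginal. *)
Lemma cvg_tent (I : Type) (F : set_system I) {FF : Filter F} (f g : I -> R)
    (a b : R) : f @ F --> a -> g @ F --> b ->
  tent (f i) (g i) @[i --> F] --> tent a b.
Proof.
move=> fa gb.
have cmax : continuous (fun z : R => Num.max 0 z).
  have c0 : continuous (cst 0 : R -> R) by exact: cst_continuous.
  by apply: (max_fun_continuous c0) => z; exact: cvg_id.
apply: cvgM; first by apply: cvgM => //; exact: cvg_cst.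
apply: (continuous_cvg _ (cmax _)).
apply: cvgB; first exact: cvg_cst.
apply: cvgM => //; apply: cvg_norm; apply: cvgD => //; exact: cvg_cst.
Qed.

Lemma measurable_tent : measurable_fun [set: T * T]
  (fun p => tent p.1 p.2).
Proof.
apply: measurable_funM.
  exact: measurable_funM.
apply: measurable_maxr => //.
apply: measurable_funB => //.
apply: measurable_funM => //.
apply: measurableT_comp => //.
exact: measurable_funD.
Qed.

Lemma measurable_tentr (h : R) : measurable_fun [set: T] (tent h).
Proof.
exact: (measurableT_comp measurable_tent (pair1_measurable (h : T))).
Qed.

Lemma integral_tent (h : R) : 1 <= h ->
  (\int[unit_lebesgue]_t (tent h t)%:E = 1)%E.
Proof.
move=> h1.
have h0 : 0 < h by lra.
have hV : h^-1 <= 1 by rewrite invf_le1.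
have hV0 : 0 < h^-1 by rewrite invr_gt0.
rewrite ge0_integral_unit_lebesgue; last 2 first.
- by apply/measurable_EFinP; exact: measurable_tentr.
- by move=> t; rewrite lee_fin tent_ge0// ltW.
(* [g] is the decreasing branch of the tent, valid from [a] to [b]. Since [1 <= h], the point [b]
   stays in the interval; beyond it the tent is 0. *)
pose g t := 2 * h * (1 - h * (t + 2^-1)).
pose a := - 2^-1 : R; pose b := - 2^-1 + h^-1.
transitivity (\int[lebesgue_measure]_(t in `[a, b]) (g t)%:E)%E.
  rewrite integral_mkcond [RHS]integral_mkcond; apply: eq_integral => t _.
  rewrite !patchE; have [tab|tab] := boolP (t \in `[a, b]%classic).
    have : a <= t <= b by move: tab; rewrite inE/= in_itv.
    rewrite /a /b => /andP[ta tb].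
    rewrite mem_set; last by rewrite /unit_itv/= in_itv/=; lra.
    rewrite /tent /g ger0_norm ?max_r//; last by lra.
    rewrite subr_ge0 -ler_pdivlMl// mulr1; lra.
  have [|//] := boolP (t \in unit_itv).
  rewrite inE /unit_itv/= in_itv/= => /andP[ta tb].
  have bt : b < t.
    rewrite ltNge; apply: contra tab => tb'.
    by rewrite inE/= in_itv/= ta tb'.
  rewrite /tent max_l ?mulr0// subr_le0 ger0_norm; last by lra.
  by rewrite -ler_pdivrMl// mulr1; rewrite /b in bt; lra.
(* An antiderivative of [g] that vanishes at [a] and equals [2 - 1] at [b]. *)
pose G t := 2 * h * (t + 2^-1) - (h * (t + 2^-1)) ^+ 2.
have dG (x : R) : is_derive x 1 G (g x).
  by rewrite /G /g; apply: is_derive_eq;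
    rewrite scaler0 addr0 /GRing.scale/=; ring.
have cG (x : R) : {for x, continuous G}.
  by apply/differentiable_continuous/derivable1_diffP; exact: ex_derive.
rewrite (@continuous_FTC2 _ g G)//.
- rewrite -EFinB; congr EFin; rewrite /G /a /b; field; lra.
- by rewrite /a /b ltrDl.
- apply: continuous_subspaceT => x.
  by apply/differentiable_continuous/derivable1_diffP; exact: ex_derive.
- split.
  + by move=> x _; exact: ex_derive.
  + by apply: cvg_at_right_filter; exact: cG.
  + by apply: cvg_at_left_filter; exact: cG.
- by move=> x _; rewrite derive1E; exact: derive_val.
Qed.

Lemma measurable_tent_excess (h : R) :
  measurable_fun [set: T] (fun t => Num.max 0 (tent h t - 1)).
Proof.
apply: measurable_maxr => //; apply: measurable_funB => //.
exact: measurable_tentr.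
Qed.

(* The tent exceeds 1 at most on its base, so capping it at 1 keeps at most the
   length [h^-1] of the base. *)
Lemma integral_tent_excess (h : R) : 1 <= h ->
  ((1 - h^-1)%:E <= \int[unit_lebesgue]_t (Num.max 0 (tent h t - 1))%:E)%E.
Proof.
move=> h1.
have h0 : 0 < h by lra.
have hV : h^-1 <= 1 by rewrite invf_le1.
have hV0 : 0 < h^-1 by rewrite invr_gt0.
(* The base of the two-sided tent. Its right half alone lies in the interval, whence a measure of at
   most [h^-1]. *)
pose A : set T := `[- 2^-1 - h^-1, - 2^-1 + h^-1]%classic.
have mA : measurable A by exact: measurable_itv.
have Ale : (unit_lebesgue A <= h^-1%:E)%E.
  have -> : h^-1%:E = lebesgue_measure `[- 2^-1, - 2^-1 + h^-1]%classic.
    rewrite lebesgue_measure_itv/= lte_fin ltrDl hV0 -EFinB; congr EFin; lra.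
  apply: le_measure; rewrite ?inE//.
    by apply: measurableI => //; exact: measurable_unit_itv.
  move=> t [] /=; rewrite /A /unit_itv/= !in_itv/=.
  by move=> /andP[_ ->] /andP[->].
rewrite EFinB leeBlDr// -{1}(integral_tent h)//.
apply: (@le_trans _ _ (\int[unit_lebesgue]_t
    ((Num.max 0 (tent h t - 1))%:E + (\1_A t)%:E))%E).
  apply: ge0_le_integral => //.
  - by move=> t _; rewrite lee_fin tent_ge0// ltW.
  - by apply/measurable_EFinP; exact: measurable_tentr.
  - apply: emeasurable_funD; apply/measurable_EFinP => //.
    exact: measurable_tent_excess.
  - move=> t _; rewrite -EFinD lee_fin indicE.
    have [tA|tA] := boolP (t \in A).
      by rewrite -lerBlDr le_max lexx orbT.
    rewrite addr0 {1}/tent [in leLHS]max_l ?mulr0 ?le_max ?lexx// subr_le0.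
    rewrite leNgt; apply: contra tA => th.
    have : `|t + 2^-1| < h^-1 by rewrite -[ltRHS]mulr1 ltr_pdivlMl.
    by rewrite ltr_norml inE /A/= in_itv/= => ?; lra.
rewrite ge0_integralD//=.
- by rewrite integral_indic// setIT leeD2l.
- by move=> t _; rewrite lee_fin le_max lexx.
- by apply/measurable_EFinP; exact: measurable_tent_excess.
- by apply/measurable_EFinP.
Qed.
End tent.

(** * Supports, and almost everywhere bounds on continuous functions *)

Section support.
Context {R : realType}.
Local Notation T := (measurableTypeR R).

Lemma closed_msupport (mu : probability T R) : closed (msupport mu).
Proof.
rewrite -openC openE => x /existsNP[U /not_implyP[[oU Ux] /negP muU]].
apply: (filterS (P := U)); last exact: open_nbhs_nbhs.
move=> y Uy /(_ U (conj oU Uy)) muU0.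
by move/negP : muU; exact.
Qed.

(** A support contained in a segment would be compact, being closed. *)
Lemma msupport_unbounded (mu : probability T R) : ~ compact (msupport mu) ->
  forall M, exists2 x, msupport mu x & M <= `|x|.
Proof.
move=> ncpt M; apply: contrapT => nx; apply: ncpt.
apply: (subclosed_compact (closed_msupport _) (@segment_compact _ (- M) M)).
move=> x sx; rewrite /= in_itv/= -ler_norml leNgt; apply/negP => Mx.
by apply: nx; exists x => //; exact: ltW.
Qed.

Lemma msupport_ball (mu : probability T R) x e : msupport mu x -> 0 < e ->
  (0 < mu (ball (x : R) e))%E.
Proof.
move=> sx e0; apply: sx; split; first exact: ball_open.
exact: ballxx.
Qed.

Lemma unit_lebesgue_ball (x e : R) : unit_itv x -> 0 < e ->
  (0 < unit_lebesgue (ball x e `&` unit_itv))%E.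
Proof.
rewrite {1}/unit_itv/= in_itv/= => /andP[x1 x2] e0.
(* The ball is cut at the ends of the interval; what remains is nondegenerate even when [x] is an
   endpoint. *)
pose a := Num.max (x - e) (- 2^-1).
pose b := Num.min (x + e) 2^-1.
have ab : a < b by rewrite lt_min !gt_max; lra.
have mab : measurable (`]a, b[%classic : set T) by exact: measurable_itv.
have mbu : measurable (ball x e `&` unit_itv : set T).
  by apply: measurableI; [exact: measurable_ball|exact: measurable_unit_itv].
apply: (@lt_le_trans _ _ (lebesgue_measure `]a, b[%classic)).
  by rewrite lebesgue_measure_itv/= lte_fin ab -EFinB lte_fin subr_gt0.
rewrite /unit_lebesgue /mrestr.
apply: le_measure; rewrite ?inE//.
  by apply: measurableI => //; exact: measurable_unit_itv.
move=> t /=; rewrite in_itv/= lt_min gt_max /ball/= /unit_itv/= in_itv/=.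
rewrite ltr_distlC.
move=> /andP[/andP[t1 t2] /andP[t3 t4]].
split; last by lra.
by split; lra.
Qed.

Lemma of_row_row n (x : n.-tuple T) : of_row (\row_j tnth x j) = x.
Proof. by apply: eq_from_tnth => i; rewrite tnth_mktuple mxE. Qed.

(** If [c < f x], continuity keeps [f] above [c] on the part of a ball about [x] inside the box.
    Balls of row vectors are boxes of balls, so this part has a product of positive numbers as its
    measure and fits in no null set. *)
Lemma continuous_on_ae_le n (mu : 'I_n -> probability T R) (X : 'I_n -> set T)
    (f : n.-tuple T -> R) (c : R) (x : n.-tuple T) :
  (forall j, measurable (X j)) -> box X x ->
  (forall j e, 0 < e -> (0 < mu j (ball (tnth x j : R) e `&` X j))%E) ->
  continuous_on X f -> {ae prodm mu, forall y, f y <= c} -> f x <= c.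
Proof.
move=> mX Xx mux /subspace_continuousP cf [B [mB B0 fB]].
rewrite leNgt; apply/negP => cfx.
pose v : 'rV[R]_n := \row_j tnth x j.
have Xv : (@of_row R n @^-1` box X) v by rewrite /= of_row_row.
have nfv : nbhs ((f \o @of_row R n) v) [set r | c < r].
  by rewrite /= of_row_row; exact: open_nbhs_nbhs.
move: (cf _ Xv _ nfv) => /nbhs_ballP[e /= e0 ef].
pose C := box (fun j => ball (tnth x j : R) e `&` X j) : set (n.-tuple T).
have CB : C `<=` B.
  move=> y Cy; apply: fB; apply/negP; rewrite -ltNge.
  have := ef (\row_j tnth y j).
  rewrite /from_subspace /= of_row_row; apply=> [|j]; last exact: (Cy j).2.
  by split => // i j; rewrite !mxE; exact: (Cy j).1.
have mC : measurable C.
  by apply: measurable_box => j; apply: measurableI => //;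
    exact: measurable_ball.
have : (prodm mu C <= 0)%E by rewrite -B0; apply: le_measure; rewrite ?inE.
rewrite prodm_box; last first.
  by move=> j; apply: measurableI => //; exact: measurable_ball.
apply/negP; rewrite -ltNge.
elim/big_ind : _ => // [p q p0 q0|j _]; first exact: mule_gt0.
exact: mux.
Qed.

End support.

(** * Slices of the product, and marginals as integrals along them *)

Section insert_at.
Context {R : realType}.

Lemma tnth_insert_at n (j : 'I_n) (t : R) y : tnth (insert_at j t y) j = t.
Proof. by rewrite tnth_mktuple unlift_none. Qed.

Lemma tnth_insert_at_lift n (j : 'I_n) (t : R) y k :
  tnth (insert_at j t y) (lift j k) = tnth y k.
Proof. by rewrite tnth_mktuple liftK. Qed.

Lemma measurable_insert_at n (j : 'I_n) (t : R) :
  measurable_fun setT (insert_at j t : n.-1.-tuple (measurableTypeR R) -> _).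
Proof.
apply/measurable_fun_tnthP => i.
have [k ->|->] := unliftP j i.
  rewrite [X in measurable_fun _ X](_ : _ = fun y => tnth y k).
    exact: measurable_tnth.
  by apply/funext => y; rewrite /= tnth_insert_at_lift.
rewrite [X in measurable_fun _ X](_ : _ = cst t); first exact: measurable_cst.
by apply/funext => y; rewrite /= tnth_insert_at.
Qed.

Lemma box_insert_at n (X : 'I_n -> set R) (j : 'I_n) (t : R) y :
  X j t -> box (fun k => X (lift j k)) y -> box X (insert_at j t y).
Proof.
move=> Xt Xy i; have [k ->|->] := unliftP j i.
  by rewrite tnth_insert_at_lift; exact: Xy.
by rewrite tnth_insert_at.
Qed.

End insert_at.

Section coordinates.
Context {R : realType}.
Local Notation T := (measurableTypeR R).
Context (mu1 : probability T R).

Lemma measurable_coord_space n (j : 'I_n) :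
  measurable (coord_space j : set T).
Proof.
by rewrite /coord_space; case: ifP => // _; exact: measurable_unit_itv.
Qed.

Lemma unit_lebesgue_unit_itv : unit_lebesgue (unit_itv : set R) = 1%E.
Proof.
by rewrite -unit_lebesgue_setT /unit_lebesgue /mrestr setTI setIid.
Qed.

Lemma coord_measure_space n (j : 'I_n) :
  coord_measure mu1 j (coord_space j) = 1%E.
Proof.
rewrite /coord_measure /coord_space; case: ifP => // _.
  exact: probability_setT.
exact: unit_lebesgue_unit_itv.
Qed.

Lemma ge0_integral_unit_itv (f : T -> \bar R) : measurable_fun setT f ->
  (forall t, 0 <= f t)%E ->
  (\int[unit_lebesgue]_(t in unit_itv) f t = \int[unit_lebesgue]_t f t)%E.
Proof.
move=> mf f0; have mu := @measurable_unit_itv R.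
rewrite [RHS](@ge0_negligible_integral _ _ _ unit_lebesgue setT
  (~` unit_itv))//.
- by rewrite setTD setCK.
- exact: measurableC.
- by rewrite /= /unit_lebesgue /mrestr setICl measure0.
Qed.

Lemma ge0_marg n (j : 'I_n) (P : n.-tuple T -> R) (t : R) :
  measurable_fun setT P -> (forall x, 0 <= P x) ->
  marg (@coord_space R n) (coord_measure mu1) j P t =
  (\int[prodm (fun k => coord_measure mu1 (lift j k))]_y
    (P (insert_at j t y))%:E)%E.
Proof.
move=> mP P0; rewrite /marg ge0_integral_prodm_box// => [j0|j0||y].
- exact: measurable_coord_space.
- exact: coord_measure_space.
- apply/measurable_EFinP; apply: measurableT_comp => //.
  exact: measurable_insert_at.
- by rewrite lee_fin.
Qed.

End coordinates.

(** * The plan, its marginals, and the plans close to it *)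

Definition plan {R : realType} {n : nat} (H : R -> R)
    (x : n.+2.-tuple (measurableTypeR R)) : R :=
  tent (H (tnth x ord0)) (tnth x (lift ord0 ord0)).

Section plan.
Context {R : realType}.
Local Notation T := (measurableTypeR R).
Context (n : nat) (mu1 : probability T R) (H : R -> R).
Context (cH : continuous H).
Context (H1 : forall x, 1 <= H x).
Context (iH : mu1.-integrable setT (EFin \o H)).

Local Notation X := (@coord_space R n.+2).
Local Notation mu := (@coord_measure R n.+2 mu1).
Local Notation i1 := (lift ord0 ord0 : 'I_n.+2).

Local Notation plan := (@plan R n H).

Let H0 x : 0 <= H x. Proof. exact: le_trans (H1 x). Qed.

Let mH : measurable_fun [set: T] (H : T -> R).
Proof. exact: continuous_measurable_fun. Qed.

Lemma plan_ge0 x : 0 <= plan x. Proof. exact: tent_ge0. Qed.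

Lemma measurable_tentH : measurable_fun [set: T * T]
  (fun p => tent (H p.1) p.2).
Proof.
apply: (measurableT_comp measurable_tent
  (g := fun p : T * T => (H p.1 : T, p.2))).
by apply/measurable_fun_pair => //=; apply: measurableT_comp.
Qed.

Lemma measurable_plan : measurable_fun setT plan.
Proof.
apply: (measurableT_comp measurable_tentH
  (g := fun x : n.+2.-tuple T => (tnth x ord0, tnth x i1))).
by apply/measurable_fun_pair; exact: measurable_tnth.
Qed.

Lemma continuous_plan : continuous_on X plan.
Proof.
rewrite /continuous_on (_ : plan \o _ = fun w : 'rV[R]_n.+2 =>
    tent (H (w ord0 ord0)) (w ord0 i1)); last first.
  by apply/funext => w; rewrite /plan /= !tnth_mktuple.
apply: continuous_subspaceT => v.
apply: (@cvg_tent _ _ (nbhs v) (nbhs_filter v)); last exact: coord_continuous.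
have c0 := @coord_continuous R 1 n.+2 ord0 ord0 v.
exact: (continuous_cvg _ (cH _) c0).
Qed.

Lemma marg_plan0 t : marg X mu ord0 plan t = 1%E.
Proof.
rewrite ge0_marg; [|exact: measurable_plan|exact: plan_ge0].
rewrite -(integral_tent _ (H1 t)).
under eq_integral do rewrite /plan tnth_insert_at tnth_insert_at_lift.
rewrite (ge0_integral_prodm_coord0 _ _ (fun b => (tent (H t) b)%:E))//.
- by apply/measurable_EFinP; exact: measurable_tentr.
- by move=> a; rewrite lee_fin tent_ge0.
Qed.

Lemma marg_plan1 t :
  marg X mu i1 plan t = (\int[mu1]_s (tent (H s) t)%:E)%E.
Proof.
rewrite ge0_marg; [|exact: measurable_plan|exact: plan_ge0].
have p0 (y : n.+1.-tuple T) : tnth (insert_at i1 t y) ord0 = tnth y ord0.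
  by rewrite -(tnth_insert_at_lift _ i1 t); congr tnth; exact: val_inj.
under eq_integral do rewrite /plan tnth_insert_at p0.
rewrite (ge0_integral_prodm_coord0 _ _ (fun b => (tent (H b) t)%:E))//.
- apply/measurable_EFinP.
  exact: (measurableT_comp measurable_tentH (pair2_measurable (t : T))).
- by move=> a; rewrite lee_fin tent_ge0.
Qed.

Lemma integral_plan_line :
  (\int[mu1]_s \int[unit_lebesgue]_t (tent (H s) t)%:E = 1)%E.
Proof.
under eq_integral do rewrite integral_tent//.
rewrite integral_cst// mul1e; exact: probability_setT.
Qed.

Lemma marg_plan2 (j : 'I_n) t :
  marg X mu (lift ord0 (lift ord0 j)) plan t = 1%E.
Proof.
rewrite ge0_marg; [|exact: measurable_plan|exact: plan_ge0].
(* An index [j : 'I_n] forces [n] to be positive, so deleting coordinate [k] leaves at least two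
   coordinates, the first two unchanged. *)
set k := lift _ _; case: n j @k => [[]//|m] j k.
have p0 (y : m.+2.-tuple T) : tnth (insert_at k t y) ord0 = tnth y ord0.
  by rewrite -(tnth_insert_at_lift _ k t); congr tnth; exact: val_inj.
have p1 (y : m.+2.-tuple T) : tnth (insert_at k t y) (lift ord0 ord0) =
    tnth y (lift ord0 ord0).
  by rewrite -(tnth_insert_at_lift _ k t); congr tnth; exact: val_inj.
transitivity (\int[prodm (fun i => coord_measure mu1 (lift k i))]_y
    (tent (H (tnth y ord0)) (tnth y (lift ord0 ord0)))%:E)%E.
  by apply: eq_integral => y _; congr (tent (H _) _)%:E; [exact: p0|exact: p1].
rewrite (ge0_integral_prodm_coord01 _ _ (fun p => (tent (H p.1) p.2)%:E))//.
- exact: integral_plan_line.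
- by apply/measurable_EFinP; exact: measurable_tentH.
- by move=> a; rewrite lee_fin tent_ge0.
Qed.

Lemma marg_plan_unit (j : 'I_n.+1) t : marg X mu (lift ord0 j) plan t =
  if j == ord0 then (\int[mu1]_s (tent (H s) t)%:E)%E else 1%E.
Proof.
have [k ->|->] := unliftP ord0 j; first exact: marg_plan2.
by rewrite marg_plan1.
Qed.

Let rho1 (t : R) := \int[mu1]_s (tent (H s) t).

(** [2 * H] dominates the tents uniformly in [t]. This is where the integrability of [H] makes the
    second marginal finite and continuous. *)
Let i2H : mu1.-integrable setT (fun s => (2 * H s)%:E).
Proof. by under eq_fun do rewrite EFinM; exact: integrableZl. Qed.

Lemma integrable_tentH t : mu1.-integrable setT (fun s => (tent (H s) t)%:E).
Proof.
apply: le_integrable i2H => //.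
- apply/measurable_EFinP.
  exact: (measurableT_comp measurable_tentH (pair2_measurable (t : T))).
- move=> s _; rewrite lee_fin !ger0_norm ?tent_ge0 ?mulr_ge0//.
  exact: tent_le.
Qed.

Lemma rho1E t : (\int[mu1]_s (tent (H s) t)%:E = (rho1 t)%:E)%E.
Proof.
rewrite /rho1 /Rintegral fineK//; apply: integrable_fin_num => //.
exact: integrable_tentH.
Qed.

Lemma continuous_rho1 : continuous rho1.
Proof.
move=> a.
(* The dominating function does not depend on [t], so any open interval around [a] will do. *)
have : a \in `]a - 1, a + 1[%classic by rewrite inE/= in_itv/=; lra.
apply: (@continuity_under_integral _ _ _ mu1 (fun t s => tent (H s) t) setT
  measurableT _ _ _ _ (fun s => 2 * H s)).
- by move=> x _; exact: integrable_tentH.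
- apply: aeW => s _ t _; apply: cvg_tent; [exact: cvg_cst|exact: cvg_id].
- exact: i2H.
- move=> x _; apply: aeW => s _; rewrite ger0_norm ?tent_ge0//.
  exact: tent_le.
Qed.

Lemma is_marginal_cst (j : 'I_n.+2) : is_marginal (X j) (mu j) (cst 1).
Proof.
split => //; first by apply: continuous_subspaceT => x; exact: cvg_cst.
rewrite (integral_cst _ (measurable_coord_space _ j) 1%E) mul1e.
exact: coord_measure_space.
Qed.

Lemma is_marginal_plan (j : 'I_n.+2) :
  is_marginal (X j) (mu j) (fun t => fine (marg X mu j plan t)).
Proof.
have [k ->|->] := unliftP ord0 j; last first.
  under eq_fun do rewrite marg_plan0.
  exact: is_marginal_cst.
under eq_fun do rewrite marg_plan_unit.
case: eqP => [->|_]; last exact: is_marginal_cst.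
under eq_fun do rewrite rho1E /=.
split.
- by apply: continuous_subspaceT; exact: continuous_rho1.
- by move=> t _; apply: Rintegral_ge0 => s _; exact: tent_ge0.
rewrite /coord_space/= /coord_measure/=.
rewrite ge0_integral_unit_itv//.
- under eq_integral do rewrite -rho1E.
  (* Tonelli turns the mass of the second marginal into an integral over the first coordinate of
     tents of mass 1. *)
  rewrite -(fubini_tonelli (fun p : T * T => (tent (H p.1) p.2)%:E))//=.
  + exact: integral_plan_line.
  + by apply/measurable_EFinP; exact: measurable_tentH.
  + by move=> p; rewrite lee_fin tent_ge0.
- by apply/measurable_EFinP; exact: continuous_measurable_fun continuous_rho1.
- by move=> t; rewrite lee_fin; apply: Rintegral_ge0 => s _; exact: tent_ge0.
Qed.

Lemma marg_plan_fin j t : marg X mu j plan t = (fine (marg X mu j plan t))%:E.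
Proof.
have [k ->|->] := unliftP ord0 j; last by rewrite marg_plan0.
by rewrite marg_plan_unit; case: ifP => // _; rewrite rho1E.
Qed.

Lemma coupling_plan : coupling X mu plan.
Proof.
exists (fun j t => fine (marg X mu j plan t)); first exact: is_marginal_plan.
split; first exact: continuous_plan.
- by move=> x _; exact: plan_ge0.
- by move=> j t _; exact: marg_plan_fin.
Qed.

(** Since [s] is in the support of [mu1] and the other measures charge every ball about a point of
    the interval, continuity makes the almost everywhere bound hold at every point of the slice.
    There [P'] is at least the positive part of [tent (H s) - 1], whose mass [integral_tent_excess]
    bounds below. *)
Lemma close_plan_marg0_ge (P' : n.+2.-tuple T -> R) (s : R) :
  continuous_on X P' -> (forall x, box X x -> 0 <= P' x) ->
  {ae prodm mu, forall x, `|plan x - P' x| <= 1} -> msupport mu1 s ->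
  ((1 - (H s)^-1)%:E <= marg X mu ord0 P' s)%E.
Proof.
move=> cP' P'0 aeP' ss.
have cf : continuous_on X (fun x => `|plan x - P' x|).
  move=> v; apply: cvg_norm; apply: cvgB; first exact: continuous_plan.
  exact: cP'.
have close y : box (fun k => X (lift ord0 k)) y ->
    plan (insert_at ord0 s y) - 1 <= P' (insert_at ord0 s y).
  move=> Xy; set x := insert_at _ _ _.
  have Xx : box X x by exact: box_insert_at.
  suff : `|plan x - P' x| <= 1 by rewrite ler_norml; lra.
  apply: (continuous_on_ae_le _ mu X _ _ x _ _ _ cf aeP') => //.
    exact: measurable_coord_space.
  move=> j e e0; have [k ->|->] := unliftP ord0 j.
    exact: (unit_lebesgue_ball _ _ (Xx (lift ord0 k)) e0).
  rewrite setIT; apply: msupport_ball => //.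
  by rewrite tnth_insert_at.
have mex : measurable_fun setT (fun y : n.+1.-tuple T =>
    (Num.max 0 (tent (H s) (tnth y ord0) - 1))%:E).
  apply/measurable_EFinP.
  apply: (measurableT_comp (measurable_tent_excess (H s))).
  exact: measurable_tnth.
have ex0 (y : n.+1.-tuple T) :
    (0 <= (Num.max 0 (tent (H s) (tnth y ord0) - 1))%:E)%E.
  by rewrite lee_fin le_max lexx.
rewrite (le_trans (integral_tent_excess (H s) (H1 s)))//.
rewrite -(ge0_integral_prodm_coord0 _
  (fun k : 'I_n.+1 => mu (lift ord0 k)))//; last 2 first.
- by apply/measurable_EFinP; exact: measurable_tent_excess.
- by move=> t; rewrite lee_fin le_max lexx.
rewrite -(ge0_integral_prodm_box _ _
  (fun k => X (lift ord0 k)))//; last 2 first.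
- by move=> j; exact: measurable_coord_space.
- by move=> j; exact: coord_measure_space.
(* [P'] is arbitrary off the box and comes with continuity only, hence this form of monotonicity. *)
apply: ge0_le_integral_nonmeasurable => //= y Xy.
rewrite lee_fin ge_max P'0/=; last exact: box_insert_at.
by rewrite (le_trans _ (close y Xy))// /plan tnth_insert_at tnth_insert_at_lift.
Qed.

End plan.

(** * Sup norms and almost everywhere bounds *)

Section Lnorm_infty.
Context {d} {Y : measurableType d} {R : realType} (P : probability Y R).
Local Open Scope ereal_scope.

(** The norm of exponent [+oo] is defined by cases on the total mass; positivity selects the
    essential supremum. *)
Let P_gt0 : 0 < P [set: Y].
Proof. by have /= -> := probability_setT P. Qed.

Lemma Lnorm_infty_le (f : Y -> \bar R) (e : \bar R) :
  (forall x, `|f x| <= e) -> 'N[P]_+oo[f] <= e.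
Proof.
by move=> fe; rewrite unlock ifT//; apply/ess_supP; exact: aeW.
Qed.

Lemma Lnorm_infty_ae (f : Y -> \bar R) (e : \bar R) :
  'N[P]_+oo[f] <= e -> {ae P, forall x, `|f x| <= e}.
Proof. by rewrite unlock ifT// => /ess_supP. Qed.

End Lnorm_infty.

(** * Perturbations of the constant marginal *)

Section perturbation.
Context {R : realType}.
Local Notation T := (measurableTypeR R).
Context (mu : probability T R) (H : R -> R).
Context (cH : continuous H).
Context (H1 : forall x, 1 <= H x).

Let HV_gt0 x : 0 < (H x)^-1.
Proof. by rewrite invr_gt0 (lt_le_trans ltr01). Qed.

Let HV_le1 x : (H x)^-1 <= 1.
Proof. by rewrite invf_le1// (lt_le_trans ltr01). Qed.

Let cHV : continuous (fun x => (H x)^-1).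
Proof.
by move=> x; apply: cvgV; [rewrite gt_eqF// (lt_le_trans ltr01)|exact: cH].
Qed.

Let mHV : measurable_fun [set: T] (fun x => ((H x)^-1)%:E).
Proof. by apply/measurable_EFinP; exact: continuous_measurable_fun cHV. Qed.

(** For positivity: a zero integral would make [1 / H] vanish almost everywhere, and as it vanishes
    nowhere the whole line would be null. *)
Lemma integral_inv_in01 : exists c, [/\ 0 < c, c <= 1 &
  (\int[mu]_x ((H x)^-1)%:E = c%:E)%E].
Proof.
have le1 : (\int[mu]_x ((H x)^-1)%:E <= 1)%E.
  have <- : (\int[mu]_x (cst 1%E x) = 1)%E.
    by rewrite integral_cst// mul1e; exact: probability_setT.
  by apply: ge0_le_integral => // x _; rewrite lee_fin// ltW.
have ge0 : (0 <= \int[mu]_x ((H x)^-1)%:E)%E.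
  by apply: integral_ge0 => x _; rewrite lee_fin ltW.
have fin : (\int[mu]_x ((H x)^-1)%:E)%E \is a fin_num.
  by rewrite ge0_fin_numE// (le_lt_trans le1)// ltry.
exists (fine (\int[mu]_x ((H x)^-1)%:E)%E); rewrite fineK//.
split => //; last first.
  by rewrite -lee_fin fineK.
rewrite -lte_fin fineK// lt_neqAle ge0 andbT; apply/negP => /eqP/esym int0.
have intabs : (\int[mu]_x `|((H x)^-1)%:E| = 0)%E.
  rewrite -[RHS]int0; apply: eq_integral => x _.
  by rewrite gee0_abs// lee_fin ltW.
have [N [mN N0 sN]] := (ae_eq_integral_abs mu measurableT mHV).1 intabs.
have NT : N = setT.
  apply/seteqP; split=> // x _; apply: sN => /(_ I)/eqP.
  by rewrite eqe gt_eqF.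
suff : (0 = 1 :> \bar R)%E by move=> /eqP; rewrite eq_sym onee_eq0.
by rewrite -N0 NT; exact: probability_setT.
Qed.

(** Subtracting the mean [c] preserves the total mass, and [delta * c <= 1] preserves the sign. *)
Lemma is_marginal_perturbation (c delta : R) : 0 < c -> c <= 1 ->
  0 <= delta -> delta <= 1 -> (\int[mu]_x ((H x)^-1)%:E = c%:E)%E ->
  is_marginal setT mu (fun t => 1 + delta * ((H t)^-1 - c)).
Proof.
move=> c0 c1 d0 d1 intc.
have dc0 : 0 <= 1 - delta * c by rewrite subr_ge0 mulr_ile1// ltW.
split.
- apply: continuous_subspaceT => x; apply: cvgD; first exact: cvg_cst.
  apply: cvgM; first exact: cvg_cst.
  by apply: cvgB; [exact: cHV|exact: cvg_cst].
- move=> t _; have := HV_gt0 t.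
  have dh : 0 <= delta * (H t)^-1 by rewrite mulr_ge0// ltW.
  lra.
(* Regrouped as a sum of two nonnegative functions, so that the integral splits. *)
- transitivity (\int[mu]_x
      ((cst (1 - delta * c)%:E x) + delta%:E * ((H x)^-1)%:E))%E.
    by apply: eq_integral => x _; rewrite -EFinM -EFinD; congr EFin; ring.
  rewrite ge0_integralD//.
  + rewrite integral_cst// ge0_integralZl//; last first.
      by move=> x _; rewrite lee_fin ltW.
    have /= -> := probability_setT mu.
    by rewrite intc mule1 -EFinM -EFinD subrK.
  + by move=> x _; rewrite -EFinM lee_fin mulr_ge0// ltW.
  + by apply: emeasurable_funM.
Qed.
End perturbation.

(** * Choice of the perturbation, and a contradiction far out in the support *)

Theorem mainTheorem2 (R : realType) (N : nat) (hN : (2 <= N)%N)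
    (mu1 : probability (measurableTypeR R) R)
    (hmu1 : ~ compact (msupport mu1)) :
  let X : 'I_N -> set R := @coord_space R N in
  let mu : 'I_N -> probability (measurableTypeR R) R :=
    @coord_measure R N mu1 in
  exists P : N.-tuple (measurableTypeR R) -> R,
  coupling X mu P /\
  exists eps : R, 0 < eps /\
  forall sigma : R, 0 < sigma ->
  exists rho : 'I_N -> R -> R,
  [/\ forall j : 'I_N, is_marginal (X j) (mu j) (rho j),
      forall j : 'I_N,
        ('N[mu j]_+oo[(fun t => marg X mu j P t - (rho j t)%:E)] < sigma%:E)%E
    & ~ exists P' : N.-tuple (measurableTypeR R) -> R,
          transport_plans X mu rho P' /\
          ('N[prodm mu]_+oo[(fun x => (P x - P' x)%:E)] < eps%:E)%E].
Proof.
case: N hN => [//|[//|n]] _ X mu.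
have [H [cH H1 properH iH]] := exists_proper_integrable mu1.
have [c [c0 c1 intc]] := integral_inv_in01 mu1 H cH H1.
exists (@plan R n H); split; first exact: coupling_plan.
(* The closeness 1 is the height at which [integral_tent_excess] cuts the tents. *)
exists 1; split=> // sigma sigma0.
(* Halving makes [delta < sigma] strict; [delta <= 1] keeps the perturbed marginal nonnegative. *)
pose delta := Num.min 1 sigma / 2.
have delta0 : 0 < delta by rewrite divr_gt0// lt_min ltr01.
have delta1 : delta <= 1.
  by rewrite ler_pdivrMr// mul1r ge_min; apply/orP; left; lra.
have deltas : delta < sigma.
  by rewrite ltr_pdivrMr// gt_min; apply/orP; right; lra.
pose rho (j : 'I_n.+2) t := if j == ord0 then 1 + delta * ((H t)^-1 - c)
  else fine (marg X mu j (@plan R n H) t).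
exists rho; split.
- move=> j; rewrite /rho; case: eqP => [->|_]; last exact: is_marginal_plan.
  by apply: (is_marginal_perturbation mu1 H cH H1 c) => //; exact: ltW.
- move=> j; apply: (@le_lt_trans _ _ delta%:E); last by rewrite lte_fin.
  apply: Lnorm_infty_le => t; rewrite /rho; case: eqP => [->|_]; last first.
    rewrite -marg_plan_fin// subee// ?abse0 ?lee_fin ?ltW//.
    by rewrite (marg_plan_fin _ mu1 H cH H1 iH).
  rewrite marg_plan0// -EFinB lee_fin.
  have HV0 : 0 < (H t)^-1 by rewrite invr_gt0 (lt_le_trans ltr01).
  have HV1 : (H t)^-1 <= 1 by rewrite invf_le1// (lt_le_trans ltr01).
  rewrite opprD addrA subrr sub0r normrN normrM gtr0_norm//.
  (* Both [(H t)^-1] and [c] lie between 0 and 1, so they differ by at most 1. *)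
  by rewrite ler_piMr ?(ltW delta0)// ler_norml; lra.
move=> [P' [[cP' P'0 margP'] closeP']].
have dc0 : 0 < delta * c by rewrite mulr_gt0.
(* The bound [1 - 1 / H s <= 1 + delta * (1 / H s - c)] on the slice amounts to
   [H s <= (1 + delta) / (delta * c)]; adding 1 makes [H s] violate it strictly. *)
have [M MH] := properH ((1 + delta) / (delta * c) + 1).
have [s ss Ms] := msupport_unbounded mu1 hmu1 M.
have Hs := MH s Ms.
have H0 : 0 < H s by rewrite (lt_le_trans ltr01).
have aeP' : {ae prodm mu, forall x, `|plan H x - P' x| <= 1}.
  have := Lnorm_infty_ae _ _ _ (ltW closeP').
  by apply: filterS => x; rewrite /= lee_fin.
have := close_plan_marg0_ge _ mu1 H cH H1 P' s cP' P'0 aeP' ss.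
rewrite margP'// /rho eqxx lee_fin.
have : (1 + delta) / (delta * c) < H s by lra.
rewrite ltr_pdivrMr// -ltr_pdivrMl// => Hc.
have := Hc; rewrite mulrDr mulr1 => {}Hc.
nra.
Qed.
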